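(* Let $A=(A,\preccurlyeq,\to,S)$ be an arrow algebra and $j$ a nucleus on $A$. Let $P$ be the tripos induced by $A$ and let $P_j$ be the tripos induced by the arrow algebra $A_j=(A,\preccurlyeq,\to_j,S_j)$, where $a\to_j b:=a\to jb$ and $S_j:=\{a\in A: ja\in S\}$. Then $P_j$ is a subtripos of $P$.
   Context: An arrow structure is a complete poset $(A,\preccurlyeq)$ (infima $\bigwedge$) with a binary operation $\to$ such that $a'\preccurlyeq a$ and $b\preccurlyeq b'$ imply $a\to b\preccurlyeq a'\to b'$. The operation $\to$ associates to the right and binds stronger than $\bigwedge$. A separator on it is a subset $S\subseteq A$ such that: (1) $a\in S$, $a\preccurlyeq b$ imply $b\in S$; (2) $a\to b\in S$ and $a\in S$ imply $b\in S$; (3) $S$ contains $$\mathbf k=\bigwedge_{a,b\in A}a\to b\to a,\qquad \mathbf s=\bigwedge_{a,b,c\in A}(a\to b\to c)\to(a\to b)\to(a\to c),$$ $$\mathbf a=\bigwedge_{x,I,(y_i)_{i\in I},(z_i)_{i\in I}}\Big(\bigwedge_{i\in I}x\to y_i\to z_i\Big)\to x\to\Big(\bigwedge_{i\in I}y_i\to z_i\Big),$$ where in $\mathbf a$ the infimum is over all $x\in A$, all sets $I$ and all $I$-indexed families in $A$ (equivalently, $\mathbf a=\bigwedge_{a\in A,\,B\subseteq \mathrm{Im}(\to)}(\bigwedge_{b\in B}a\to b)\to a\to\bigwedge_{b\in B}b$). An arrow algebra is an arrow structure together with a separator on it. A nucleus on an arrow algebra $(A,\preccurlyeq,\to,S)$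 is a map $j:A\to A$ such that: (1) $a\preccurlyeq b$ implies $ja\preccurlyeq jb$; (2) $\bigwedge_{a\in A}a\to ja\in S$; (3) $\bigwedge_{a,b\in A}(a\to jb)\to(ja\to jb)\in S$. For a nucleus $j$, $A_j$ is again an arrow algebra. The tripos induced by an arrow algebra $(A,\preccurlyeq,\to,S)$ is the functor $P:\mathbf{Set}^{\rm op}\to\mathbf{preHeyt}$ (preHeyting algebras, i.e. preorders whose poset reflection is a Heyting algebra) with $PI=A^I$ preordered by $\varphi\vdash\psi$ iff $\bigwedge_{i\in I}\varphi(i)\to\psi(i)\in S$, and with $Pf$ given by precomposition with $f$. A geometric morphism $Q\to P$ of triposes over $\mathbf{Set}$ is a pair $\Phi=(\Phi_+,\Phi^+)$ of natural transformations $\Phi^+:P\to Q$ and $\Phi_+:Q\to P$ (with monotone components) such that for every set $X$ the component $\Phi^+_X:P(X)\to Q(X)$ is left adjoint to $\Phi_+^X:Q(X)\to P(X)$ and preserves finite meets. It is an inclusion of triposes if for every set $X$ the map $\Phi_+^X$ also reflects the preorder (is full). In this case $Q$ is called a subtripos of $P$. *)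

(* Defs.v *)
From Stdlib Require Import List Relation_Definitions.
Import ListNotations.

Set Implicit Arguments.
Unset Strict Implicit.

Record arrow_structure := ArrowStructure {
  carrier :> Type;
  ale : relation carrier;
  ale_order : order carrier ale;
  inf : (carrier -> Prop) -> carrier;
  inf_lb : forall (B : carrier -> Prop) b, B b -> ale (inf B) b;
  inf_glb : forall (B : carrier -> Prop) a,
    (forall b, B b -> ale a b) -> ale a (inf B);
  arr : carrier -> carrier -> carrier;
  arr_mono : forall a a' b b', ale a' a -> ale b b' -> ale (arr a b) (arr a' b')
}.

Notation "a '~>' b" := (arr a b) (at level 55, right associativity).
Notation "a '≼' b" := (ale a b) (at level 70, no associativity).

Definition infF (A : arrow_structure) (I : Type) (F : I -> A) : A :=
  inf (fun v => exists i, v = F i).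

Notation "'⋀' i , F" := (infF (fun i => F))
  (at level 65, i binder, right associativity, F at level 65).

Definition comb_k (A : arrow_structure) : A :=
  inf (fun v : A => exists a b : A, v = a ~> b ~> a).

Definition comb_s (A : arrow_structure) : A :=
  inf (fun v : A => exists a b c : A,
    v = (a ~> b ~> c) ~> (a ~> b) ~> (a ~> c)).

Definition comb_a (A : arrow_structure) : A :=
  inf (fun v : A => exists (x : A) (I : Type) (y z : I -> A),
    v = (⋀ i, x ~> y i ~> z i) ~> x ~> (⋀ i, y i ~> z i)).

Record is_separator (A : arrow_structure) (S : A -> Prop) : Prop := {
  sep_up : forall a b, S a -> a ≼ b -> S b;
  sep_mp : forall a b, S (a ~> b) -> S a -> S b;
  sep_k : S (comb_k A);
  sep_s : S (comb_s A);
  sep_a : S (comb_a A)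
}.

Record arrow_algebra := ArrowAlgebra {
  astr :> arrow_structure;
  sep : astr -> Prop;
  sepP : is_separator sep
}.

Record is_nucleus (A : arrow_algebra) (j : A -> A) : Prop := {
  nuc_mono : forall a b : A, a ≼ b -> j a ≼ j b;
  nuc_unit : sep (⋀ a : A, a ~> j a);
  nuc_bind : sep (inf (fun v : A => exists a b : A,
                         v = (a ~> j b) ~> (j a ~> j b)))
}.

(* The poset reflection of a preorder has finite meets, finite joins and
   relative pseudo-complements iff the preorder itself has them, where their
   universal properties determine them up to isomorphism. *)

Definition is_top (X : Type) (le : relation X) (t : X) : Prop :=
  forall c, le c t.
Definition is_bot (X : Type) (le : relation X) (b : X) : Prop :=
  forall c, le b c.
Definition is_meet (X : Type) (le : relation X) (a b m : X) : Prop :=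
  forall c, le c m <-> le c a /\ le c b.
Definition is_join (X : Type) (le : relation X) (a b m : X) : Prop :=
  forall c, le m c <-> le a c /\ le b c.
Definition is_imp (X : Type) (le : relation X) (a b h : X) : Prop :=
  forall c m, is_meet le c a m -> (le c h <-> le m b).

Record preHeyt := PreHeyt {
  pcar :> Type;
  ple : relation pcar;
  ple_preorder : preorder pcar ple;
  ph_top : exists t, is_top ple t;
  ph_bot : exists b, is_bot ple b;
  ph_meet : forall a b, exists m, is_meet ple a b m;
  ph_join : forall a b, exists m, is_join ple a b m;
  ph_imp : forall a b, exists h, is_imp ple a b h
}.

Definition monotone (X Y : preHeyt) (f : X -> Y) : Prop :=
  forall a b, ple a b -> ple (f a) (f b).

Record preserves_finite_meets (X Y : preHeyt) (f : X -> Y) : Prop := {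
  pres_top : forall t, is_top (@ple X) t -> is_top (@ple Y) (f t);
  pres_meet : forall a b m,
    is_meet (@ple X) a b m -> is_meet (@ple Y) (f a) (f b) (f m)
}.

Record is_preHeyt_hom (X Y : preHeyt) (f : X -> Y) : Prop := {
  hom_mono : monotone f;
  hom_meets : preserves_finite_meets f;
  hom_bot : forall b, is_bot (@ple X) b -> is_bot (@ple Y) (f b);
  hom_join : forall a b m,
    is_join (@ple X) a b m -> is_join (@ple Y) (f a) (f b) (f m);
  hom_imp : forall a b h,
    is_imp (@ple X) a b h -> is_imp (@ple Y) (f a) (f b) (f h)
}.

Definition left_adjoint (X Y : preHeyt) (f : X -> Y) (g : Y -> X) : Prop :=
  forall a b, ple (f a) b <-> ple a (g b).

Definition iso (X : preHeyt) (a b : X) : Prop := ple a b /\ ple b a.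

(* Functors from Set^op to preHeyt, sets being types. *)
Record indexed_preHeyt := IndexedPreHeyt {
  fib :> Type -> preHeyt;
  reindex : forall X Y : Type, (X -> Y) -> fib Y -> fib X;
  reindex_hom : forall (X Y : Type) (f : X -> Y), is_preHeyt_hom (reindex f);
  reindex_id : forall (X : Type) (p : fib X), reindex (fun x => x) p = p;
  reindex_comp : forall (X Y Z : Type) (f : X -> Y) (g : Y -> Z) (p : fib Z),
    reindex (fun x => g (f x)) p = reindex f (reindex g p)
}.

Definition is_pullback (W X Y Z : Type)
    (p : W -> X) (q : W -> Y) (f : X -> Z) (g : Y -> Z) : Prop :=
  (forall w, f (p w) = g (q w)) /\
  (forall x y, f x = g y -> exists! w, p w = x /\ q w = y).

Record is_tripos (P : indexed_preHeyt) : Prop := {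
  tripos_exists : forall (X Y : Type) (f : X -> Y),
    exists E : P X -> P Y, left_adjoint E (reindex (i := P) f);
  tripos_forall : forall (X Y : Type) (f : X -> Y),
    exists U : P X -> P Y, left_adjoint (reindex (i := P) f) U;
  tripos_BC_exists : forall (W X Y Z : Type)
      (p : W -> X) (q : W -> Y) (f : X -> Z) (g : Y -> Z)
      (Ep : P W -> P X) (Eg : P Y -> P Z),
    is_pullback p q f g ->
    left_adjoint Ep (reindex p) -> left_adjoint Eg (reindex g) ->
    forall phi : P Y, iso (reindex f (Eg phi)) (Ep (reindex q phi));
  tripos_BC_forall : forall (W X Y Z : Type)
      (p : W -> X) (q : W -> Y) (f : X -> Z) (g : Y -> Z)
      (Up : P W -> P X) (Ug : P Y -> P Z),
    is_pullback p q f g ->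
    left_adjoint (reindex p) Up -> left_adjoint (reindex g) Ug ->
    forall phi : P Y, iso (reindex f (Ug phi)) (Up (reindex q phi));
  tripos_generic : exists (Sigma : Type) (gen : P Sigma),
    forall (X : Type) (phi : P X),
      exists f : X -> Sigma, iso phi (reindex f gen)
}.

Record tripos := Tripos {
  tfun :> indexed_preHeyt;
  triposP : is_tripos tfun
}.

Definition is_natural (P Q : indexed_preHeyt)
    (F : forall X : Type, P X -> Q X) : Prop :=
  forall (X Y : Type) (f : X -> Y) (p : P Y),
    F X (reindex f p) = reindex f (F Y p).

Record geometric_morphism (Q P : tripos) := GeometricMorphism {
  inverse_image : forall X : Type, P X -> Q X;
  direct_image : forall X : Type, Q X -> P X;
  inverse_natural : is_natural inverse_image;
  direct_natural : is_natural direct_image;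
  inverse_mono : forall X : Type, monotone (inverse_image (X := X));
  direct_mono : forall X : Type, monotone (direct_image (X := X));
  inverse_direct_adj : forall X : Type,
    left_adjoint (inverse_image (X := X)) (direct_image (X := X));
  inverse_meets : forall X : Type,
    preserves_finite_meets (inverse_image (X := X))
}.

Definition is_inclusion (Q P : tripos) (Phi : geometric_morphism Q P) : Prop :=
  forall (X : Type) (a b : Q X),
    ple (direct_image Phi a) (direct_image Phi b) -> ple a b.

Definition is_subtripos (Q P : tripos) : Prop :=
  exists Phi : geometric_morphism Q P, is_inclusion Phi.

Lemma ale_refl (A : arrow_structure) (a : A) : a ≼ a.
Proof. apply (ord_refl _ _ (ale_order A)). Qed.

Lemma ale_trans (A : arrow_structure) (a b c : A) : a ≼ b -> b ≼ c -> a ≼ c.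
Proof. apply (ord_trans _ _ (ale_order A)). Qed.

Lemma infF_lb (A : arrow_structure) (I : Type) (F : I -> A) i : infF F ≼ F i.
Proof. apply inf_lb; now exists i. Qed.

Lemma infF_glb (A : arrow_structure) (I : Type) (F : I -> A) a :
  (forall i, a ≼ F i) -> a ≼ infF F.
Proof. intros H; apply inf_glb; intros b [i ->]; apply H. Qed.

Definition top (A : arrow_structure) : A := inf (fun _ => False).
Definition bot (A : arrow_structure) : A := inf (fun _ => True).

Lemma ale_top (A : arrow_structure) (a : A) : a ≼ top A.
Proof. now apply inf_glb. Qed.

Lemma bot_ale (A : arrow_structure) (a : A) : bot A ≼ a.
Proof. now apply inf_lb. Qed.

Definition valid (A : arrow_algebra) (I : Type) (F : I -> A) : Prop :=
  sep (infF F).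

Definition impf (A : arrow_structure) (I : Type) (F G : I -> A) : I -> A :=
  fun i => F i ~> G i.

Definition imps (A : arrow_structure) (I : Type)
    (l : list (I -> A)) (F : I -> A) : I -> A := fold_right (@impf A I) F l.

(* Uniform derivability of F from the hypotheses l. *)
Definition nd (A : arrow_algebra) (I : Type) (l : list (I -> A)) (F : I -> A) :=
  valid (imps l F).

Lemma valid_sub (A : arrow_algebra) (I K : Type) (F : I -> A) (G : K -> A) :
  valid F -> (forall k, exists i, F i ≼ G k) -> valid G.
Proof.
intros HF H; apply (sep_up (sepP A) HF), infF_glb; intros k.
destruct (H k) as [i Hi]; apply (ale_trans (infF_lb F i) Hi).
Qed.

Lemma valid_inf (A : arrow_algebra) (I : Type) (F : I -> A) (B : A -> Prop) :
  valid F -> (forall b, B b -> exists i, F i ≼ b) -> sep (inf B).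
Proof.
intros HF H; apply (sep_up (sepP A) HF), inf_glb; intros b Hb.
destruct (H b Hb) as [i Hi]; apply (ale_trans (infF_lb F i) Hi).
Qed.

Lemma valid_sep (A : arrow_algebra) (I : Type) (F : I -> A) (a : A) :
  sep a -> (forall i, a ≼ F i) -> valid F.
Proof. intros Ha H; apply (sep_up (sepP A) Ha), infF_glb, H. Qed.

Lemma valid_k (A : arrow_algebra) (I : Type) (F G : I -> A) :
  valid (fun i => F i ~> G i ~> F i).
Proof.
apply (valid_sep (sep_k (sepP A))); intros i; apply inf_lb.
now exists (F i), (G i).
Qed.

Lemma valid_s (A : arrow_algebra) (I : Type) (F G H : I -> A) :
  valid (fun i => (F i ~> G i ~> H i) ~> (F i ~> G i) ~> (F i ~> H i)).
Proof.
apply (valid_sep (sep_s (sepP A))); intros i; apply inf_lb.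
now exists (F i), (G i), (H i).
Qed.

Lemma valid_a (A : arrow_algebra) (T : Type) (I : T -> Type) (x : T -> A)
    (y z : forall t, I t -> A) :
  valid (fun t => (⋀ i, x t ~> y t i ~> z t i) ~> x t ~> (⋀ i, y t i ~> z t i)).
Proof.
apply (valid_sep (sep_a (sepP A))); intros t; apply inf_lb.
now exists (x t), (I t), (y t), (z t).
Qed.

Lemma valid_mp (A : arrow_algebra) (I : Type) (F G H : I -> A) :
  valid (fun i => F i ~> G i ~> H i) -> valid F -> valid (fun i => G i ~> H i).
Proof.
(* The families are indexed by their image, so that the universe of I need not
   be bounded by that of the index sets in comb_a. *)
intros H1 H2; pose (I' := {p : A * A | exists i, p = (G i, H i)}).
pose (y := fun p : I' => fst (proj1_sig p)).
pose (z := fun p : I' => snd (proj1_sig p)).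
assert (H3 : valid (fun p => y p ~> z p)).
{ refine (sep_mp (sepP A) _ H2).
  refine (sep_mp (sepP A) (a := ⋀ p, infF F ~> y p ~> z p) _ _).
  - apply (sep_up (sepP A) (sep_a (sepP A))), inf_lb.
    now exists (infF F), I', y, z.
  - apply (valid_sub H1); intros [p [i Hi]]; exists i; unfold y, z; simpl.
    rewrite Hi; apply arr_mono; [apply infF_lb | apply ale_refl]. }
apply (valid_sub H3); intros i.
exists (exist _ (G i, H i) (ex_intro _ i eq_refl)); apply ale_refl.
Qed.

Lemma valid_id (A : arrow_algebra) (I : Type) (F : I -> A) :
  valid (fun i => F i ~> F i).
Proof.
assert (H := valid_s F (fun i => F i ~> F i) F).
apply (valid_mp (valid_mp H (valid_k F (fun i => F i ~> F i))) (valid_k F F)).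
Qed.

Lemma valid_comp (A : arrow_algebra) (I : Type) (F G H : I -> A) :
  valid (fun i => F i ~> G i) -> valid (fun i => G i ~> H i) ->
  valid (fun i => F i ~> H i).
Proof.
intros H1 H2; refine (valid_mp (valid_mp (valid_s F G H) _) H1).
apply (valid_mp (valid_k (fun i => G i ~> H i) F) H2).
Qed.

Lemma nd_weak1 (A : arrow_algebra) (I : Type) (x : I -> A) l F :
  nd l F -> nd (x :: l) F.
Proof. apply (valid_mp (valid_k (imps l F) x)). Qed.

Lemma nd_closed (A : arrow_algebra) (I : Type) (l : list (I -> A)) F :
  valid F -> nd l F.
Proof.
intros HF; induction l as [|x l IH]; [exact HF | now apply nd_weak1].
Qed.

Lemma nd_head (A : arrow_algebra) (I : Type) (x : I -> A) l : nd (x :: l) x.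
Proof.
induction l as [|y l IH]; [apply valid_id |].
apply (valid_comp (G := imps l x)); [exact IH | apply valid_k].
Qed.

Lemma nd_top (A : arrow_algebra) (I : Type) (l : list (I -> A)) :
  nd l (fun _ => top A).
Proof.
apply nd_closed, (valid_sep (sep_k (sepP A))); intros _; apply ale_top.
Qed.

Lemma nd_hyp (A : arrow_algebra) (I : Type) (l : list (I -> A)) n :
  nd l (nth n l (fun _ => top A)).
Proof.
revert n; induction l as [|x l IH]; intros [|n].
- apply (nd_top (A := A) (I := I) []).
- apply (nd_top (A := A) (I := I) []).
- apply nd_head.
- apply nd_weak1, IH.
Qed.

Lemma imps_app (A : arrow_algebra) (I : Type) (l : list (I -> A)) F G :
  valid (fun i => imps l (impf F G) i ~> imps l F i ~> imps l G i).
Proof.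
induction l as [|x l IH]; [apply valid_id |].
set (p := imps l (impf F G)) in *; set (q := imps l F) in *.
set (r := imps l G) in *.
change (valid (fun i => (x i ~> p i) ~> (x i ~> q i) ~> (x i ~> r i))).
apply (valid_comp (G := fun i => x i ~> q i ~> r i)); [| apply valid_s].
refine (valid_mp (valid_s x p (fun i => q i ~> r i)) _).
apply (valid_mp (valid_k (fun i => p i ~> q i ~> r i) x) IH).
Qed.

Lemma nd_app (A : arrow_algebra) (I : Type) (F : I -> A) x l G :
  nd (x :: l) (impf F G) -> nd (x :: l) F -> nd (x :: l) G.
Proof.
intros H1 H2; exact (valid_mp (valid_mp (imps_app (x :: l) F G) H1) H2).
Qed.

Lemma nd_mono (A : arrow_algebra) (I : Type) (l : list (I -> A)) F G :
  nd l F -> (forall i, F i ≼ G i) -> nd l G.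
Proof.
intros H1 H; apply (valid_sub H1); intros i; exists i.
clear H1; induction l as [|x l IH]; [apply H |].
apply arr_mono; [apply ale_refl | exact IH].
Qed.

Lemma nd_inf_elim (A : arrow_algebra) (I : Type) (K : I -> Type)
    (F : forall i, K i -> A) (l : list (I -> A)) (k : forall i, K i) :
  nd l (fun i => infF (F i)) -> nd l (fun i => F i (k i)).
Proof. intros H; apply (nd_mono H); intros i; apply infF_lb. Qed.

Definition pull (A : arrow_structure) (T : Type) (K : T -> Type) (F : T -> A) :
  {t & K t} -> A := fun tk => F (projT1 tk).

Lemma imps_inf (A : arrow_algebra) (T : Type) (K : T -> Type)
    (y z : forall t, K t -> A) (l : list (T -> A)) :
  valid (fun t =>
    (⋀ k : K t, imps (map (pull (K := K)) l)
       (fun tk => y _ (projT2 tk) ~> z _ (projT2 tk)) (existT K t k))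
    ~> imps l (fun t => ⋀ k : K t, y t k ~> z t k) t).
Proof.
induction l as [|x l IH]; [apply valid_id |].
set (w := imps (map (pull (K := K)) l)
            (fun tk => y _ (projT2 tk) ~> z _ (projT2 tk))) in *.
assert (Hw : exists u v : forall t, K t -> A,
  forall t k, w (existT K t k) = u t k ~> v t k).
{ subst w; destruct l as [|x' l].
  - now exists y, z.
  - now exists (fun t _ => x' t),
      (fun t k => imps (map (pull (K := K)) l)
         (fun tk => y _ (projT2 tk) ~> z _ (projT2 tk)) (existT K t k)). }
destruct Hw as (u & v & Hw).
apply (valid_comp (G := fun t => x t ~> (⋀ k : K t, w (existT K t k)))).
- apply (valid_sub (valid_a (T := T) x u v)); intros t; exists t.
  apply arr_mono.
  + apply infF_glb; intros k; rewrite <- Hw.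
    apply (infF_lb (fun k : K t => impf (pull (K := K) x) w (existT K t k))).
  + apply arr_mono; [apply ale_refl |].
    apply infF_glb; intros k; rewrite Hw.
    apply (infF_lb (fun k => u t k ~> v t k)).
- refine (valid_mp (valid_s x _ (imps l _)) _).
  refine (valid_mp (valid_k _ x) IH).
Qed.

Lemma nd_inf_intro (A : arrow_algebra) (T : Type) (K : T -> Type)
    (y z : forall t, K t -> A) x (l : list (T -> A)) :
  nd (map (pull (K := K)) (x :: l))
     (fun tk => y _ (projT2 tk) ~> z _ (projT2 tk)) ->
  nd (x :: l) (fun t => ⋀ k : K t, y t k ~> z t k).
Proof.
intros H; refine (valid_mp (imps_inf y z (x :: l)) _).
apply (sep_up (sepP A) H), infF_glb; intros t; apply infF_glb; intros k.
exact (infF_lb _ (existT K t k)).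
Qed.

Lemma nd_unit (A : arrow_algebra) (j : A -> A) (hj : is_nucleus j)
    (I : Type) (F : I -> A) x l :
  nd (x :: l) F -> nd (x :: l) (fun i => j (F i)).
Proof.
apply nd_app, nd_closed, (valid_sub (nuc_unit hj)).
intros i; exists (F i); apply ale_refl.
Qed.

Lemma nd_bind (A : arrow_algebra) (j : A -> A) (hj : is_nucleus j)
    (I : Type) (F G : I -> A) x l :
  nd (x :: l) (fun i => j (F i)) -> nd (x :: l) (fun i => F i ~> j (G i)) ->
  nd (x :: l) (fun i => j (G i)).
Proof.
intros H1 H2; refine (nd_app _ H1); refine (nd_app _ H2).
apply nd_closed, (valid_sep (nuc_bind hj)); intros i; apply inf_lb.
now exists (F i), (G i).
Qed.

Lemma sep_unit (A : arrow_algebra) (j : A -> A) (hj : is_nucleus j) (a : A) :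
  sep a -> sep (j a).
Proof.
intros Ha; refine (sep_mp (sepP A) _ Ha).
refine (sep_up (sepP A) (nuc_unit hj) _); exact (infF_lb (fun a => a ~> j a) a).
Qed.

Definition nucleus_structure (A : arrow_algebra) (j : A -> A)
    (hj : is_nucleus j) : arrow_structure :=
  @ArrowStructure A (@ale A) (ale_order A) (@inf A) (@inf_lb A) (@inf_glb A)
    (fun a b => a ~> j b)
    (fun a a' b b' ha hb => arr_mono ha (nuc_mono hj hb)).

Lemma nucleus_separator (A : arrow_algebra) (j : A -> A) (hj : is_nucleus j) :
  is_separator (A := nucleus_structure hj) (fun a : A => sep (j a)).
Proof.
split.
- intros a b Ha Hab; exact (sep_up (sepP A) Ha (nuc_mono hj Hab)).
- refine (fun (a b : A) Hab Ha => _); refine (sep_mp (sepP A) _ Ha).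
  refine (sep_mp (sepP A) _ Hab).
  pose (x := fun _ : unit => j (a ~> j b)); pose (y := fun _ : unit => j a).
  assert (H : nd [x; y] (fun _ => j b)).
  { apply (nd_bind hj (F := fun _ => a)); [exact (nd_hyp [x; y] 1) |].
    change (nd [x; y; fun _ => a] (fun _ => j b)).
    apply (nd_bind hj (F := fun _ => a ~> j b)).
    - exact (nd_hyp [x; y; fun _ => a] 0).
    - change (nd [x; y; fun _ => a; fun _ => a ~> j b] (fun _ => j b)).
      apply (nd_app (F := fun _ => a)).
      + exact (nd_hyp [x; y; fun _ => a; fun _ => a ~> j b] 3).
      + exact (nd_hyp [x; y; fun _ => a; fun _ => a ~> j b] 2). }
  exact (sep_up (sepP A) H (infF_lb _ tt)).
- apply (sep_unit hj).
  apply valid_inf with (I := (A * A)%type)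
    (F := fun p => fst p ~> j (snd p ~> j (fst p))).
  + pose (a := fun p : A * A => fst p); pose (b := fun p : A * A => snd p).
    change (nd [a] (fun p => j (b p ~> j (a p)))).
    apply (nd_unit hj); change (nd [a; b] (fun p => j (a p))).
    apply (nd_unit hj); exact (nd_hyp [a; b] 0).
  + intros v (a & b & ->); exists (a, b); apply ale_refl.
- apply (sep_unit hj).
  pose (a := fun p : A * A * A => fst (fst p)).
  pose (b := fun p : A * A * A => snd (fst p)).
  pose (c := fun p : A * A * A => snd p).
  pose (h := fun p => a p ~> j (b p ~> j (c p))).
  pose (g := fun p => a p ~> j (b p)).
  apply valid_inf with (I := (A * A * A)%type)
    (F := fun p => h p ~> j (g p ~> j (a p ~> j (c p)))).
  + change (nd [h] (fun p => j (g p ~> j (a p ~> j (c p))))).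
    apply (nd_unit hj); change (nd [h; g] (fun p => j (a p ~> j (c p)))).
    apply (nd_unit hj); change (nd [h; g; a] (fun p => j (c p))).
    apply (nd_bind hj (F := fun p => b p ~> j (c p))).
    * apply (nd_app (F := a)); [exact (nd_hyp [h; g; a] 0) |].
      exact (nd_hyp [h; g; a] 2).
    * pose (d := fun p => b p ~> j (c p)).
      change (nd [h; g; a; d] (fun p => j (c p))).
      apply (nd_bind hj (F := b)).
      -- apply (nd_app (F := a)); [exact (nd_hyp [h; g; a; d] 1) |].
         exact (nd_hyp [h; g; a; d] 2).
      -- exact (nd_hyp [h; g; a; d] 3).
  + intros v (x & y & z & ->); exists (x, y, z); apply ale_refl.
- apply (sep_unit hj).
  pose (T := {x : A & {I : Type & ((I -> A) * (I -> A))%type}}).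
  pose (x := fun t : T => projT1 t).
  pose (K := fun t : T => projT1 (projT2 t)).
  pose (y := fun (t : T) => fst (projT2 (projT2 t)) : K t -> A).
  pose (z := fun (t : T) => snd (projT2 (projT2 t)) : K t -> A).
  pose (h := fun t : T => ⋀ k : K t, x t ~> j (y t k ~> j (z t k))).
  apply valid_inf with (I := T)
    (F := fun t => h t ~> j (x t ~> j (⋀ k : K t, y t k ~> j (z t k)))).
  + change (nd [h] (fun t => j (x t ~> j (⋀ k : K t, y t k ~> j (z t k))))).
    apply (nd_unit hj).
    change (nd [h; x] (fun t => j (⋀ k : K t, y t k ~> j (z t k)))).
    apply (nd_unit hj), (nd_inf_intro (z := fun t k => j (z t k))).
    pose (h' := pull (K := K) h); pose (x' := pull (K := K) x).
    pose (y' := fun tk : {t & K t} => y _ (projT2 tk)).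
    pose (z' := fun tk : {t & K t} => z _ (projT2 tk)).
    change (nd [h'; x'; y'] (fun tk => j (z' tk))).
    apply (nd_bind hj (F := fun tk => y' tk ~> j (z' tk))).
    * apply (nd_app (F := x')); [| exact (nd_hyp [h'; x'; y'] 1)].
      apply (nd_inf_elim (K := fun tk => K (projT1 tk))
               (F := fun tk k => x' tk ~> j (y _ k ~> j (z _ k)))
               (fun tk => projT2 tk)).
      exact (nd_hyp [h'; x'; y'] 0).
    * pose (d := fun tk => y' tk ~> j (z' tk)).
      change (nd [h'; x'; y'; d] (fun tk => j (z' tk))).
      apply (nd_app (F := y')); [exact (nd_hyp [h'; x'; y'; d] 3) |].
      exact (nd_hyp [h'; x'; y'; d] 2).
  + intros v (a & I & u & w & ->); exists (existT _ a (existT _ I (u, w))).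
    apply ale_refl.
Qed.

Definition nucleus_algebra (A : arrow_algebra) (j : A -> A)
    (hj : is_nucleus j) : arrow_algebra :=
  ArrowAlgebra (nucleus_separator hj).

Definition entails (A : arrow_algebra) (I : Type) : relation (I -> A) :=
  fun phi psi => sep (⋀ i, phi i ~> psi i).

Lemma entails_preorder (A : arrow_algebra) (I : Type) :
  preorder (I -> A) (@entails A I).
Proof. split; [intros F; apply valid_id | intros F G H; apply valid_comp]. Qed.

Lemma entails_trans (A : arrow_algebra) (I : Type) (F G H : I -> A) :
  entails F G -> entails G H -> entails F H.
Proof. apply valid_comp. Qed.

Lemma entails_reindex (A : arrow_algebra) (X Y : Type) (f : X -> Y)
    (F G : Y -> A) :
  entails F G -> entails (fun x => F (f x)) (fun x => G (f x)).
Proof. intros H; apply (valid_sub H); intros x; exists (f x); apply ale_refl. Qed.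

Lemma nd_entails (A : arrow_algebra) (I : Type) (F G : I -> A) x l :
  entails F G -> nd (x :: l) F -> nd (x :: l) G.
Proof. intros H; apply nd_app, nd_closed, H. Qed.

Lemma entails_infF_dtop (A : arrow_algebra) (I : Type) (K : I -> Type)
    (F : I -> A) (G : forall i, K i -> A) :
  entails F (fun i => ⋀ k : K i, top A ~> G i k) <->
  entails (pull (K := K) F) (fun ik => G _ (projT2 ik)).
Proof.
split; intros H.
- pose (h := pull (K := K) F).
  apply (nd_app (I := {i & K i}) (F := fun _ => top A) (x := h) (l := [])).
  + apply (nd_inf_elim (I := {i & K i}) (K := fun ik => K (projT1 ik))
             (F := fun ik k => top A ~> G _ k)
             (fun ik => projT2 ik)).
    exact (entails_reindex (projT1 (P := K)) H).
  + apply nd_top.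
- apply (nd_inf_intro (x := F) (l := []) (K := K) (y := fun _ _ => top A)).
  pose (h := pull (K := K) F); pose (t := fun _ : {i & K i} => top A).
  change (nd [h; t] (fun ik => G _ (projT2 ik))).
  apply (nd_entails H); exact (nd_hyp [h; t] 0).
Qed.

Definition andf (A : arrow_algebra) (I : Type) (F G : I -> A) : I -> A :=
  fun i => ⋀ c : A, (F i ~> G i ~> top A ~> c) ~> top A ~> c.

Definition orf (A : arrow_algebra) (I : Type) (F G : I -> A) : I -> A :=
  fun i => ⋀ c : A, (F i ~> top A ~> c) ~> (G i ~> top A ~> c) ~> top A ~> c.

Definition exf (A : arrow_algebra) (X Y : Type) (f : X -> Y) (F : X -> A) :
    Y -> A :=
  fun y => ⋀ c : A, (⋀ u : {x | f x = y}, F (proj1_sig u) ~> top A ~> c)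
                     ~> top A ~> c.

Definition allf (A : arrow_algebra) (X Y : Type) (f : X -> Y) (F : X -> A) :
    Y -> A :=
  fun y => ⋀ u : {x | f x = y}, top A ~> F (proj1_sig u).

Lemma entails_top (A : arrow_algebra) (I : Type) :
  is_top (@entails A I) (fun _ => top A).
Proof. intros F; apply (nd_top (A := A) [F]). Qed.

Lemma entails_bot (A : arrow_algebra) (I : Type) :
  is_bot (@entails A I) (fun _ => bot A).
Proof.
intros F; refine (nd_mono (F := fun _ => bot A) (l := [fun _ => bot A]) _ _).
- apply nd_head.
- intros i; apply bot_ale.
Qed.

Lemma andf_l (A : arrow_algebra) (I : Type) (F G : I -> A) :
  entails (andf F G) F.
Proof.
pose (h := andf F G); change (nd [h] F).
apply (nd_app (F := fun _ => top A)); [| apply nd_top].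
apply (nd_app (F := fun i => F i ~> G i ~> top A ~> F i)).
- apply (nd_inf_elim (K := fun _ => A)
    (F := fun i c => (F i ~> G i ~> top A ~> c) ~> top A ~> c) F).
  exact (nd_hyp [h] 0).
- exact (nd_hyp [h; F; G; fun _ => top A] 1).
Qed.

Lemma andf_r (A : arrow_algebra) (I : Type) (F G : I -> A) :
  entails (andf F G) G.
Proof.
pose (h := andf F G); change (nd [h] G).
apply (nd_app (F := fun _ => top A)); [| apply nd_top].
apply (nd_app (F := fun i => F i ~> G i ~> top A ~> G i)).
- apply (nd_inf_elim (K := fun _ => A)
    (F := fun i c => (F i ~> G i ~> top A ~> c) ~> top A ~> c) G).
  exact (nd_hyp [h] 0).
- exact (nd_hyp [h; F; G; fun _ => top A] 2).
Qed.

Lemma nd_andf (A : arrow_algebra) (I : Type) (F G : I -> A) x l :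
  nd (x :: l) F -> nd (x :: l) G -> nd (x :: l) (andf F G).
Proof.
intros HF HG; refine (nd_app (nd_app _ HF) HG); apply nd_closed.
change (nd [F; G] (andf F G)).
apply (nd_inf_intro (K := fun _ : I => A)
  (y := fun i c => F i ~> G i ~> top A ~> c) (z := fun i c => top A ~> c)).
pose (F' := pull (K := fun _ => A) F); pose (G' := pull (K := fun _ => A) G).
pose (t := fun _ : {_ : I & A} => top A).
pose (c := fun p : {_ : I & A} => projT2 p).
pose (h := fun p => F' p ~> G' p ~> t p ~> c p).
change (nd [F'; G'; h] (impf t c)).
apply (nd_app (F := G')); [| exact (nd_hyp [F'; G'; h] 1)].
apply (nd_app (F := F')); [| exact (nd_hyp [F'; G'; h] 0)].
exact (nd_hyp [F'; G'; h] 2).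
Qed.

Lemma andf_meet (A : arrow_algebra) (I : Type) (F G : I -> A) :
  is_meet (@entails A I) F G (andf F G).
Proof.
intros H; split.
- intros HH; split.
  + apply (entails_trans HH), andf_l.
  + apply (entails_trans HH), andf_r.
- intros [HF HG]; exact (nd_andf (l := []) HF HG).
Qed.

Lemma orf_join (A : arrow_algebra) (I : Type) (F G : I -> A) :
  is_join (@entails A I) F G (orf F G).
Proof.
pose (t' := fun _ : {_ : I & A} => top A).
pose (c' := fun p : {_ : I & A} => projT2 p).
pose (F' := pull (K := fun _ => A) F); pose (G' := pull (K := fun _ => A) G).
pose (f' := fun p => F' p ~> t' p ~> c' p).
pose (g' := fun p => G' p ~> t' p ~> c' p).
intros H; split.
- intros HH; split.
  + refine (entails_trans _ HH).
    apply (nd_inf_intro (K := fun _ : I => A) (x := F) (l := [])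
      (y := fun i c => F i ~> top A ~> c)
      (z := fun i c => (G i ~> top A ~> c) ~> top A ~> c)).
    change (nd [F'; f'; g'] (impf t' c')).
    apply (nd_app (F := F')); [exact (nd_hyp [F'; f'; g'] 1) |].
    exact (nd_hyp [F'; f'; g'] 0).
  + refine (entails_trans _ HH).
    apply (nd_inf_intro (K := fun _ : I => A) (x := G) (l := [])
      (y := fun i c => F i ~> top A ~> c)
      (z := fun i c => (G i ~> top A ~> c) ~> top A ~> c)).
    change (nd [G'; f'; g'] (impf t' c')).
    apply (nd_app (F := G')); [exact (nd_hyp [G'; f'; g'] 2) |].
    exact (nd_hyp [G'; f'; g'] 0).
- intros [HF HG]; pose (h := orf F G); pose (t := fun _ : I => top A).
  change (nd [h] H).
  apply (nd_app (F := t)); [| apply nd_top].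
  apply (nd_app (F := fun i => G i ~> t i ~> H i)).
  + apply (nd_app (F := fun i => F i ~> t i ~> H i)).
    * apply (nd_inf_elim (K := fun _ => A) (F := fun i c =>
        (F i ~> top A ~> c) ~> (G i ~> top A ~> c) ~> top A ~> c) H).
      exact (nd_hyp [h] 0).
    * change (nd [h; F; t] H); apply (nd_entails HF); exact (nd_hyp [h; F; t] 1).
  + change (nd [h; G; t] H); apply (nd_entails HG); exact (nd_hyp [h; G; t] 1).
Qed.

Lemma impf_imp (A : arrow_algebra) (I : Type) (F G : I -> A) :
  is_imp (@entails A I) F G (impf F G).
Proof.
intros H M HM; split; intros HH.
- destruct (proj1 (HM M) (valid_id M)) as [M1 M2].
  exact (nd_app (x := M) (l := []) (entails_trans M1 HH) M2).
- assert (HA : entails (andf H F) M) by (apply HM, andf_meet, valid_id).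
  change (nd [H; F] G); apply (nd_entails HH), (nd_entails HA).
  apply nd_andf; [exact (nd_hyp [H; F] 0) | exact (nd_hyp [H; F] 1)].
Qed.

Arguments impf_imp {A I} F G [c m].

Definition arrow_fibre (A : arrow_algebra) (I : Type) : preHeyt :=
  @PreHeyt (I -> A) (@entails A I) (entails_preorder A I)
    (ex_intro _ _ (entails_top (A := A) (I := I)))
    (ex_intro _ _ (entails_bot (A := A) (I := I)))
    (fun F G => ex_intro _ _ (andf_meet F G))
    (fun F G => ex_intro _ _ (orf_join F G))
    (fun F G => ex_intro _ _ (impf_imp F G)).

Definition arrow_reindex (A : arrow_algebra) (X Y : Type) (f : X -> Y) :
  arrow_fibre A Y -> arrow_fibre A X := fun phi x => phi (f x).

Lemma arrow_reindex_hom (A : arrow_algebra) (X Y : Type) (f : X -> Y) :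
  is_preHeyt_hom (arrow_reindex (A := A) f).
Proof.
split; [| split | | |].
- intros F G; apply entails_reindex.
- intros t Ht F; refine (entails_trans (entails_top F) _).
  apply (entails_reindex f (F := fun _ => top A)), Ht.
- intros F G M HM H.
  assert (H1 : entails M (andf F G)) by (apply andf_meet, HM, valid_id).
  assert (H2 : entails (andf F G) M) by (apply HM, andf_meet, valid_id).
  split; intros HH.
  + apply (andf_meet (fun x => F (f x)) (fun x => G (f x))).
    exact (entails_trans HH (entails_reindex f H1)).
  + apply (entails_trans (proj2 (andf_meet _ _ H) HH)).
    exact (entails_reindex f H2).
- intros b Hb F; refine (entails_trans _ (entails_bot F)).
  apply (entails_reindex f (G := fun _ => bot A)), Hb.
- intros F G M HM H.
  assert (H1 : entails (orf F G) M) by (apply orf_join, HM, valid_id).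
  assert (H2 : entails M (orf F G)) by (apply HM, orf_join, valid_id).
  split; intros HH.
  + apply (orf_join (fun x => F (f x)) (fun x => G (f x))).
    exact (entails_trans (entails_reindex f H1) HH).
  + refine (entails_trans _ (proj2 (orf_join _ _ H) HH)).
    exact (entails_reindex f H2).
- intros F G K HK H M HM.
  assert (H1 : entails K (impf F G)).
  { apply (impf_imp F G (andf_meet K F)), (HK _ _ (andf_meet K F)), valid_id. }
  assert (H2 : entails (impf F G) K).
  { apply (HK _ _ (andf_meet (impf F G) F)).
    apply (impf_imp F G (andf_meet (impf F G) F)), valid_id. }
  split; intros HH.
  + apply (impf_imp (fun x => F (f x)) (fun x => G (f x)) HM).
    exact (entails_trans HH (entails_reindex f H1)).
  + refine (entails_trans (proj2 (impf_imp (fun x => F (f x)) (fun x => G (f x)) HM) HH) _).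
    exact (entails_reindex f H2).
Qed.

Definition arrow_indexed (A : arrow_algebra) : indexed_preHeyt :=
  @IndexedPreHeyt (arrow_fibre A) (arrow_reindex (A := A))
    (arrow_reindex_hom A)
    (fun _ _ => eq_refl) (fun _ _ _ _ _ _ => eq_refl).

Lemma allf_adj (A : arrow_algebra) (X Y : Type) (f : X -> Y) :
  left_adjoint (arrow_reindex f)
    (allf f : arrow_fibre A X -> arrow_fibre A Y).
Proof.
intros F G; split; intros H.
- apply (entails_infF_dtop (K := fun y => {x | f x = y})).
  apply (valid_sub H); intros [y [x e]]; exists x; subst y; apply ale_refl.
- apply entails_infF_dtop in H.
  apply (valid_sub H); intros x; exists (existT _ (f x) (exist _ x eq_refl)).
  apply ale_refl.
Qed.

Lemma exf_adj (A : arrow_algebra) (X Y : Type) (f : X -> Y) :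
  left_adjoint (exf f : arrow_fibre A X -> arrow_fibre A Y)
    (arrow_reindex f).
Proof.
intros F G; split; intros H.
- refine (entails_trans _ (entails_reindex f H)).
  apply (nd_inf_intro (K := fun _ : X => A) (x := F) (l := [])
    (y := fun x c => ⋀ u : {x' | f x' = f x}, F (proj1_sig u) ~> top A ~> c)
    (z := fun x c => top A ~> c)).
  pose (F' := pull (K := fun _ => A) F).
  pose (h := fun p : {_ : X & A} =>
    ⋀ u : {x' | f x' = f (projT1 p)}, F (proj1_sig u) ~> top A ~> projT2 p).
  change (nd [F'; h] (fun p => top A ~> projT2 p)).
  apply (nd_app (F := F')); [| exact (nd_hyp [F'; h] 0)].
  apply (nd_inf_elim (K := fun p : {_ : X & A} => {x' | f x' = f (projT1 p)})
    (F := fun p u => F (proj1_sig u) ~> top A ~> projT2 p)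
    (fun p => exist _ (projT1 p) eq_refl)).
  exact (nd_hyp [F'; h] 1).
- pose (E := exf f F); pose (t := fun _ : Y => top A).
  pose (K := fun y => {x | f x = y}).
  change (nd [E] G); apply (nd_app (F := t)); [| apply nd_top].
  apply (nd_app (F := fun y => ⋀ u : K y, F (proj1_sig u) ~> top A ~> G y)).
  + apply (nd_inf_elim (K := fun _ => A) (F := fun y c =>
      (⋀ u : K y, F (proj1_sig u) ~> top A ~> c) ~> top A ~> c) G).
    exact (nd_hyp [E] 0).
  + apply (nd_inf_intro (K := K) (y := fun _ u => F (proj1_sig u))
      (z := fun y _ => top A ~> G y)).
    apply nd_closed.
    assert (H' : valid (fun x => F x ~> top A ~> G (f x))).
    { change (nd [F; fun _ => top A] (fun x => G (f x))).
      apply (nd_entails H); exact (nd_hyp [F; fun _ => top A] 0). }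
    apply (valid_sub H'); intros [y [x e]]; exists x; subst y; apply ale_refl.
Qed.

Lemma arrow_BC_forall (A : arrow_algebra) (W X Y Z : Type)
    (p : W -> X) (q : W -> Y) (f : X -> Z) (g : Y -> Z)
    (Up : arrow_fibre A W -> arrow_fibre A X)
    (Ug : arrow_fibre A Y -> arrow_fibre A Z) :
  is_pullback p q f g ->
  left_adjoint (arrow_reindex p) Up -> left_adjoint (arrow_reindex g) Ug ->
  forall phi : arrow_fibre A Y,
    iso (arrow_reindex f (Ug phi)) (Up (arrow_reindex q phi)).
Proof.
intros [Hc Hp] HUp HUg phi; split.
- apply HUp.
  assert (H : entails (arrow_reindex g (Ug phi)) phi)
    by (apply HUg, valid_id).
  apply (valid_sub (entails_reindex q H)); intros w; exists w.
  unfold arrow_reindex; rewrite Hc; apply ale_refl.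
- assert (H : entails (allf g phi) (Ug phi))
    by (apply HUg, allf_adj, valid_id).
  refine (entails_trans _ (entails_reindex f H)).
  apply (entails_infF_dtop (K := fun x => {y | g y = f x}) _
           (fun x u => phi (proj1_sig u))).
  assert (H' : entails (arrow_reindex p (Up (arrow_reindex q phi)))
                 (arrow_reindex q phi)) by (apply HUp, valid_id).
  apply (valid_sub H'); intros [x [y e]].
  destruct (Hp x y (eq_sym e)) as [w [[<- <-] _]]; exists w; apply ale_refl.
Qed.

Lemma arrow_BC_exists (A : arrow_algebra) (W X Y Z : Type)
    (p : W -> X) (q : W -> Y) (f : X -> Z) (g : Y -> Z)
    (Ep : arrow_fibre A W -> arrow_fibre A X)
    (Eg : arrow_fibre A Y -> arrow_fibre A Z) :
  is_pullback p q f g ->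
  left_adjoint Ep (arrow_reindex p) -> left_adjoint Eg (arrow_reindex g) ->
  forall phi : arrow_fibre A Y,
    iso (arrow_reindex f (Eg phi)) (Ep (arrow_reindex q phi)).
Proof.
intros [Hc Hp] HEp HEg phi; split.
- apply allf_adj, HEg.
  assert (Hq : is_pullback q p g f).
  { split; [intros w; symmetry; apply Hc |].
    intros y x e; destruct (Hp x y (eq_sym e)) as [w [[H1 H2] Hu]].
    exists w; split; [now split | intros w' [? ?]; apply Hu; now split]. }
  refine (entails_trans _ (proj2 (arrow_BC_forall Hq (allf_adj q)
            (allf_adj f) (Ep (arrow_reindex q phi))))).
  refine (proj1 (allf_adj q _ _) _); apply HEp, valid_id.
- apply HEp.
  assert (H : entails phi (arrow_reindex g (Eg phi)))
    by (apply HEg, valid_id).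
  apply (valid_sub (entails_reindex q H)); intros w; exists w.
  unfold arrow_reindex; rewrite Hc; apply ale_refl.
Qed.

Lemma arrow_is_tripos (A : arrow_algebra) : is_tripos (arrow_indexed A).
Proof.
split.
- intros X Y f; exists (exf f); apply exf_adj.
- intros X Y f; exists (allf f); apply allf_adj.
- apply arrow_BC_exists.
- apply arrow_BC_forall.
- exists A, (fun a : A => a); intros X phi; exists phi; split; apply valid_id.
Qed.

Definition arrow_tripos (A : arrow_algebra) : tripos :=
  Tripos (arrow_is_tripos A).

(* Main.v *)
From Stdlib Require Import List.
Require Import Defs.
Import ListNotations.

Set Implicit Arguments.
Unset Strict Implicit.

(** The inclusion has the identity as inverse image and composition with [j] as
direct image.  All of it rests on one equivalence, [entails_nucleus]: [phi]
entails [psi] in the tripos of [A_j] iff [phi] entails [j o psi] in the tripos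
of [A].  This equivalence is the adjunction between the identity and
composition with [j].  The rest says that composition with [j] is a closure
operator preserving binary meets on each fibre of the tripos of [A]: the unit
law makes the direct image reflect the preorder, the bind law makes it
monotone, and preservation of meets ([entails_nucleus_meet], two uses of the
bind law) makes the identity left exact from [A] to [A_j]. *)

(** The outer [j] that [S_j] puts around the infimum of [phi i -> j (psi i)]
can be dropped: since [j] is monotone it passes to the single implications,
and the bind law absorbs it into the [j] in front of [psi i]. *)
Lemma entails_nucleus (A : arrow_algebra) (j : A -> A) (hj : is_nucleus j)
    (I : Type) (phi psi : I -> A) :
  entails (A := nucleus_algebra hj) phi psi <->
  entails (A := A) phi (fun i => j (psi i)).
Proof.
split; intros H.
- pose (d := fun i => phi i ~> j (psi i)).
  assert (Hd : valid (fun i => j (d i))).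
  { apply (valid_sep (A := A) H); intros i; apply (nuc_mono hj).
    exact (infF_lb d i). }
  change (nd [phi] (fun i => j (psi i))).
  apply (nd_bind hj (F := d)); [now apply nd_closed |].
  change (nd [phi; d] (fun i => j (psi i))).
  apply (nd_app (F := phi)); [exact (nd_hyp [phi; d] 1) |].
  exact (nd_hyp [phi; d] 0).
- exact (sep_unit hj H).
Qed.

Lemma entails_unit (A : arrow_algebra) (j : A -> A) (hj : is_nucleus j)
    (I : Type) (phi psi : I -> A) :
  entails phi psi -> entails phi (fun i => j (psi i)).
Proof. exact (nd_unit hj (l := [])). Qed.

Lemma entails_lift (A : arrow_algebra) (j : A -> A) (hj : is_nucleus j)
    (I : Type) (phi psi : I -> A) :
  entails phi (fun i => j (psi i)) ->
  entails (fun i => j (phi i)) (fun i => j (psi i)).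
Proof.
intros H; apply (nd_bind hj (F := phi) (l := [])); [apply nd_head |].
now apply (nd_closed [_]).
Qed.

(** A nucleus preserves binary meets: while proving something under [j], the
bind law replaces the hypothesis [j phi] by [phi], and then [j psi] by
[psi]. *)
Lemma entails_nucleus_meet (A : arrow_algebra) (j : A -> A)
    (hj : is_nucleus j) (I : Type) (chi phi psi mu : I -> A) :
  is_meet (@entails A I) phi psi mu ->
  entails chi (fun i => j (phi i)) -> entails chi (fun i => j (psi i)) ->
  entails chi (fun i => j (mu i)).
Proof.
intros Hmu Hphi Hpsi; change (nd [chi] (fun i => j (mu i))).
apply (nd_bind hj (F := phi)); [exact Hphi |].
change (nd [chi; phi] (fun i => j (mu i))).
apply (nd_bind hj (F := psi)).
- apply (nd_entails Hpsi); exact (nd_hyp [chi; phi] 0).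
- change (nd [chi; phi; psi] (fun i => j (mu i))); apply (nd_unit hj).
  assert (H : entails (andf phi psi) mu).
  { apply Hmu; split; [apply andf_l | apply andf_r]. }
  apply (nd_entails H), nd_andf.
  + exact (nd_hyp [chi; phi; psi] 1).
  + exact (nd_hyp [chi; phi; psi] 2).
Qed.

Lemma nucleus_id_preserves_meets (A : arrow_algebra) (j : A -> A)
    (hj : is_nucleus j) (I : Type) :
  preserves_finite_meets (X := arrow_fibre A I)
    (Y := arrow_fibre (nucleus_algebra hj) I) (fun phi => phi).
Proof.
split.
- intros t Ht chi; apply entails_nucleus, (entails_unit hj), Ht.
- intros phi psi mu Hmu chi.
  destruct (proj1 (Hmu mu) (valid_id mu)) as [H1 H2]; split.
  + intros H; apply entails_nucleus in H; split; apply entails_nucleus.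
    * exact (entails_trans H (entails_lift hj (entails_unit hj H1))).
    * exact (entails_trans H (entails_lift hj (entails_unit hj H2))).
  + intros [H3 H4]; apply entails_nucleus in H3; apply entails_nucleus in H4.
    apply entails_nucleus; exact (entails_nucleus_meet hj Hmu H3 H4).
Qed.

Definition nucleus_geometric_morphism (A : arrow_algebra) (j : A -> A)
    (hj : is_nucleus j) :
  geometric_morphism (arrow_tripos (nucleus_algebra hj)) (arrow_tripos A).
Proof.
refine (@GeometricMorphism (arrow_tripos (nucleus_algebra hj)) (arrow_tripos A)
  (fun X (phi : X -> A) => phi) (fun X (phi : X -> A) x => j (phi x))
  (fun _ _ _ _ => eq_refl) (fun _ _ _ _ => eq_refl) _ _
  (entails_nucleus hj) (nucleus_id_preserves_meets hj)).
- intros X phi psi H; apply entails_nucleus; exact (entails_unit hj H).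
- intros X phi psi H; apply entails_nucleus in H; exact (entails_lift hj H).
Defined.

Theorem proposition6p3 (A : arrow_algebra) (j : A -> A) (hj : is_nucleus j) :
  is_subtripos (arrow_tripos (nucleus_algebra hj)) (arrow_tripos A).
Proof.
exists (nucleus_geometric_morphism hj); intros X phi psi H.
apply entails_nucleus; refine (entails_trans _ H).
apply (entails_unit hj), valid_id.
Qed.
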